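(* For all integers $n\geq 3$ and $q\geq 35$, \[ f(n,q)\le \mathrm{tw}_q(n-1,q), \] i.e. $f(n,q)$ is at most a tower $q^{q^{\cdot^{\cdot^{q}}}}$ consisting of $n-1$ copies of $q$.
   Context: A word over an alphabet is a finite string of letters; a subword of $w$ is a string of consecutive letters of $w$. A word $w$ contains a pattern $P$ if there is a map assigning to each letter of $P$ a nonempty word (different letters may receive equal words) such that the word obtained from $P$ by replacing each letter by its assigned word is a subword of $w$. The Zimin words are defined by $Z_1=x_1$ and $Z_n=Z_{n-1}x_nZ_{n-1}$ with $x_n$ a new letter. $f(n,q)$ denotes the smallest integer such that every word of length $f(n,q)$ over an alphabet of size $q$ contains $Z_n$. Tower notation: $\mathrm{tw}_q(1,x)=x$, $\mathrm{tw}_q(k+1,x)=q^{\mathrm{tw}_q(k,x)}$. *)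

(* Defs.v *)
From mathcomp Require Import all_boot.
From mathcomp Require Import boolp.

Set Implicit Arguments.
Unset Strict Implicit.
Unset Printing Implicit Defensive.

Definition contains (A L : eqType) (w : seq A) (P : seq L) : Prop :=
  exists phi : L -> seq A,
    (forall x, x \in P -> phi x != [::]) /\ infix (flatten (map phi P)) w.

(* The letter x_i is the natural number i; zimin 0 is the empty word, so that
   zimin 1 = [:: 1] and zimin 2 = [:: 1; 2; 1]. *)
Fixpoint zimin (n : nat) : seq nat :=
  if n is k.+1 then zimin k ++ k.+1 :: zimin k else [::].

Definition forces_zimin (n q m : nat) : Prop :=
  forall w : seq 'I_q, size w = m -> contains w (zimin n).

Lemma zimin_le n x : x \in zimin n -> x <= n.
Proof.
elim: n => [|n IHn] //=; rewrite mem_cat inE.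
by case/or3P => [/IHn/leqW|/eqP->|/IHn/leqW].
Qed.

Lemma repeated_block (q m : nat) (w : seq 'I_q) :
    size w = (q ^ m).+1 * m.+1 ->
  exists a u c b, [/\ w = a ++ u ++ c ++ u ++ b, size u = m & c != [::]].
Proof.
move=> sw; pose N := (q ^ m).+1.
have szB (i : 'I_N) : size (take m (drop (i * m.+1) w)) == m.
  rewrite size_takel // size_drop sw leq_subRL; last first.
    by rewrite leq_mul2r /= ltnW // ltn_ord.
  apply: (@leq_trans (i.+1 * m.+1)); last by rewrite leq_mul2r ltn_ord.
  by rewrite mulSn addnC leq_add2r.
pose B (i : 'I_N) : m.-tuple 'I_q := Tuple (szB i).
have /injectivePn[i0 [j0 ne eqB]] : ~~ injectiveb B.
  apply/injectiveP => /leq_card; rewrite card_tuple !card_ord.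
  by rewrite ltnn.
wlog lt_ij : i0 j0 ne eqB / i0 < j0.
  move=> H; case: (ltngtP i0 j0) => [lt|lt|/val_inj eq].
  - exact: (H i0 j0).
  - by apply: (H j0 i0) => //; rewrite eq_sym.
  - by rewrite eq eqxx in ne.
have {}eqB : take m (drop (i0 * m.+1) w) = take m (drop (j0 * m.+1) w).
  by have := congr1 val eqB.
pose d := j0 * m.+1 - (i0 * m.+1 + m).
have ltd : i0 * m.+1 + m < j0 * m.+1.
  apply: (@leq_trans (i0.+1 * m.+1)); last by rewrite leq_mul2r lt_ij orbT.
  by rewrite mulSn addnC addSn.
have dE : d + (m + i0 * m.+1) = j0 * m.+1.
  by rewrite (addnC m) subnK // ltnW.
exists (take (i0 * m.+1) w), (take m (drop (i0 * m.+1) w)),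
  (take d (drop m (drop (i0 * m.+1) w))), (drop m (drop (j0 * m.+1) w)).
split.
- rewrite {2}eqB cat_take_drop -dE.
  by rewrite -!drop_drop !cat_take_drop.
- exact/eqP/szB.
- rewrite -size_eq0 size_takel; first by rewrite subn_eq0 -ltnNge.
  rewrite !drop_drop size_drop sw leq_subRL; last first.
    rewrite addnC (leq_trans (ltnW ltd)) // leq_mul2r /=.
    by rewrite ltnW // ltn_ord.
  by rewrite addnC dE leq_mul2r /= ltnW // ltn_ord.
Qed.

Lemma forces_zimin_ex (n q : nat) : exists m, forces_zimin n q m.
Proof.
elim: n => [|n [m Hm]].
  by exists 0 => w _; exists (fun=> [::]); split=> //; rewrite infix0s.
exists ((q ^ m).+1 * m.+1) => w /repeated_block[a [u [c [b [-> su c0]]]]].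
have [phi [phi0 /infixP[p [s uE]]]] := Hm u su.
pose psi x := if x == n.+1 then s ++ c ++ p else phi x.
have psiE x : x \in zimin n -> psi x = phi x.
  by move=> /zimin_le; rewrite /psi; case: eqP => // ->; rewrite ltnn.
have mE : map psi (zimin n) = map phi (zimin n) by exact/eq_in_map.
exists psi; split=> [x|].
  rewrite /= mem_cat inE /psi; case: eqP => /= [_ _|_ ].
    by case: (s) => //=; case: (c) c0.
  by rewrite orbb => /phi0.
rewrite /= map_cat flatten_cat /= mE {1}/psi eqxx.
by apply/infixP; exists (a ++ p), (s ++ b); rewrite {}uE -!catA.
Qed.

Lemma forces_zimin_exb (n q : nat) : exists m, `[< forces_zimin n q m >].
Proof. by have [m Hm] := forces_zimin_ex n q; exists m; apply/asboolP. Qed.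

Definition zimin_length (n q : nat) : nat := ex_minn (forces_zimin_exb n q).

Lemma zimin_lengthP (n q : nat) :
  forces_zimin n q (zimin_length n q) /\ forall m, forces_zimin n q m -> zimin_length n q <= m.
Proof.
rewrite /zimin_length; case: ex_minnP => m /asboolP Hm min_m; split=> // k Hk.
by apply: min_m; apply/asboolP.
Qed.

(* Only used for k >= 1; the value at k = 0 is a placeholder. *)
Fixpoint tw (q k x : nat) : nat :=
  match k with
  | 0 | 1 => x
  | k'.+1 => q ^ tw q k' x
  end.

(* Main.v *)
Require Import Defs.
From mathcomp Require Import all_boot.
From mathcomp Require Import zify.

Set Implicit Arguments.
Unset Strict Implicit.
Unset Printing Implicit Defensive.

(** A family [F] of words, each containing [Z_n], such that every word of
    length [L] has a factor in [F] gives [f(n+1, q) <= (#|F| + 1)(L + 1)]: cut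
    a word of that length into blocks of length [L] separated by single
    letters; two blocks share a factor [u] in [F], and [u c u] contains
    [Z_(n+1)].  Taking all words of length [m = f(n, q)] for [F] shows that
    [2 f(n, q) <= T] implies [2 f(n+1, q) <= q ^ T], so it suffices to prove
    [2 f(3, q) <= q ^ q].  There, [F] consists of the minimal words containing
    [Z_2], namely [xxx] and [x v x] where [v] is a nonempty product of
    distinct letters other than [x], each with exponent 1 or 2.  There are
    fewer than [2 ^ q * q!] of them; every word of length [2q + 1] has one as
    a factor, because a word without one is a product of distinct letters with
    exponents 1 or 2.  Finally [2 * (2 ^ q * q!) * (2q + 2) <= q ^ q] for
    [q >= 35]. *)

(** * Passing from Z_n to Z_(n+1) by pigeonhole *)

Lemma contains_ziminS (A : eqType) (n : nat) (a u c b : seq A) :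
  contains u (zimin n) -> c != [::] ->
  contains (a ++ u ++ c ++ u ++ b) (zimin n.+1).
Proof.
move=> [phi [phi0 /infixP[p [s uE]]]] c0.
(* Each copy of [u] is [p], the image of Z_n, then [s]; the new letter fills the gap between the two
   images. *)
pose psi x := if x == n.+1 then s ++ c ++ p else phi x.
have mE : map psi (zimin n) = map phi (zimin n).
  apply/eq_in_map => x /zimin_le; rewrite /psi.
  by case: eqP => // ->; rewrite ltnn.
exists psi; split=> [x|].
  rewrite /= mem_cat inE /psi; case: eqP => /= [_ _|_].
    by case: (s) => //=; case: (c) c0.
  by rewrite orbb => /phi0.
rewrite /= map_cat flatten_cat /= mE {1}/psi eqxx.
by apply/infixP; exists (a ++ p), (s ++ b); rewrite uE -!catA.
Qed.

(* The nonempty [b] is the separator between [u] and whatever follows [w]. *)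
Lemma repeated_or_many_factors (A : eqType) (F : seq (seq A)) (L k : nat)
    (w : seq A) :
  (forall v : seq A, size v = L -> exists2 u, u \in F & infix u v) ->
  size w = k * L.+1 ->
  (exists a u c b, [/\ w = a ++ u ++ c ++ u ++ b, u \in F & c != [::]]) \/
  (exists2 s : seq (seq A), uniq s /\ size s = k &
     forall u, u \in s -> u \in F /\ exists a b, w = a ++ u ++ b /\ b != [::]).
Proof.
move=> FL; elim: k w => [|k IHk] w sw; first by right; exists [::].
have sw1 : size (take (k * L.+1) w) = k * L.+1.
  by rewrite size_takel // sw leq_mul2r leqnSn orbT.
have sw2 : size (drop (k * L.+1) w) = L.+1 by rewrite size_drop sw mulSn addnK.
rewrite -(cat_take_drop (k * L.+1) w).
move: (take _ w) (drop _ w) sw1 sw2 => w1 w2 sw1 {sw}.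
case/lastP: w2 => // v z; rewrite size_rcons => -[sv].
have [u uF /infixP[p [r vE]]] := FL v sv.
have [[a [t [c [b [-> tF c0]]]]]|[s [us ss] sP]] := IHk w1 sw1.
  by left; exists a, t, c, (b ++ rcons v z); rewrite -!catA.
have [/sP[_ [a [b [-> b0]]]]|us'] := boolP (u \in s).
  (* The earlier [u] is followed by [b] up to the end of [w1], and the new one is preceded by [p] in
     its block; the gap is nonempty because [b] is. *)
  left; exists a, u, (b ++ p), (rcons r z); split=> //.
    by rewrite vE -!cats1 -!catA.
  by case: (b) b0.
right; exists (u :: s); rewrite /= ?us' ?us ?ss //.
move=> t; rewrite inE => /predU1P[->|/sP[tF [a [b [-> b0]]]]]; split=> //.
  exists (w1 ++ p), (rcons r z); split; last by case: (r).
  by rewrite vE -!cats1 -!catA.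
exists a, (b ++ rcons v z); split; first by rewrite -!catA.
by case: (b) b0.
Qed.

Lemma forces_ziminS (n q L : nat) (F : seq (seq 'I_q)) :
  (forall u, u \in F -> contains u (zimin n)) ->
  (forall v : seq 'I_q, size v = L -> exists2 u, u \in F & infix u v) ->
  forces_zimin n.+1 q ((size F).+1 * L.+1).
Proof.
move=> FZ FL w sw.
have [[a [u [c [b [-> uF c0]]]]]|[s [us ss] sP]] :=
  repeated_or_many_factors FL sw.
  exact/contains_ziminS/c0/FZ.
have /(uniq_leq_size us) : {subset s <= F} by move=> u /sP[].
by rewrite ss ltnn.
Qed.

Lemma forces_zimin_exp (n q m : nat) :
  forces_zimin n q m -> forces_zimin n.+1 q ((q ^ m).+1 * m.+1).
Proof.
move=> Hm; pose F := [seq tval t | t <- enum {: m.-tuple 'I_q}].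
have -> : q ^ m = size F by rewrite size_map -cardE card_tuple card_ord.
apply: forces_ziminS => [u /mapP[t _ ->]|v sv]; first by apply/Hm/size_tuple.
exists v; last exact: infix_refl.
by apply/mapP; exists (Tuple (introT eqP sv)); rewrite ?mem_enum.
Qed.

Lemma sumn_map_leq (T : eqType) (f : T -> nat) (c : nat) (s : seq T) :
  {in s, forall x, f x <= c} -> sumn (map f s) <= size s * c.
Proof.
elim: s => //= x s IHs fc; rewrite mulSn leq_add ?fc ?mem_head // IHs //.
by move=> y ys; rewrite fc // inE ys orbT.
Qed.

Lemma subset_rem (T : eqType) (x : T) (s v : seq T) :
  x \notin v -> {subset v <= s} -> {subset v <= rem x s}.
Proof.
move=> xv vs y yv; have [/perm_to_rem/perm_mem sE|/rem_id->] := boolP (x \in s).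
  by move: (vs y yv); rewrite sE inE; case: eqP yv xv => // -> ->.
exact: vs.
Qed.

(** * Minimal words containing Z_2 and their number *)

Section MinimalZimin2.
Variable T : eqType.
Implicit Types (x y : T) (s v w : seq T).

(* Products of distinct letters with exponents 1 or 2; equivalently, the words
   that do not contain [Z_2]. *)
Fixpoint short_runs w : bool :=
  if w is x :: v then
    (x \notin v) && short_runs v ||
    (if v is y :: v' then [&& x == y, x \notin v' & short_runs v'] else false)
  else true.

Lemma short_runs_catl v w : short_runs (v ++ w) -> short_runs v.
Proof.
(* Induction on the length, since a run of length 2 strips two letters at once. *)
have [k] := ubnP (size v); elim: k v => // k IHk [|x v] //= /ltnSE sv.
case/orP=> [/andP[xv /(IHk _ sv)->]|].
  by move: xv; rewrite mem_cat negb_or => /andP[->].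
case: v sv => [|y v] //= sv /and3P[-> xv /(IHk _ (ltnW sv))->].
by move: xv; rewrite mem_cat negb_or => /andP[->]; rewrite orbT.
Qed.

(* The [short_runs] words over [s]; [k] is fuel, meant to be [size s]. *)
Fixpoint run_words k s : seq (seq T) :=
  if k is k'.+1 then
    [::] :: flatten [seq [seq y :: v | v <- run_words k' (rem y s)] ++
                         [seq y :: y :: v | v <- run_words k' (rem y s)] | y <- s]
  else [:: [::]].

Lemma mem_run_words k s w :
  size s <= k -> {subset w <= s} -> short_runs w -> w \in run_words k s.
Proof.
elim: k s w => [|k IHk] s [|x w] //=.
  by case: s => // _ /(_ x); rewrite mem_head => /(_ isT).
move=> ss ws rw; rewrite inE /=.
have xs : x \in s by apply: ws; rewrite mem_head.
have sr : size (rem x s) <= k by rewrite size_rem //; lia.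
apply/flatten_mapP; exists x => //; rewrite mem_cat.
have {}ws : {subset w <= s} by move=> z zw; apply: ws; rewrite inE zw orbT.
case/orP: rw => [/andP[xw rw]|]; first by rewrite map_f // IHk //; apply: subset_rem.
case: w ws => // y w ws /and3P[/eqP<- xw rw].
rewrite orbC (map_f (fun v => x :: x :: v)) // IHk //; apply: subset_rem => // z zw.
by apply: ws; rewrite inE zw orbT.
Qed.

Lemma size_mem_run_words k s w : w \in run_words k s -> size w <= k.*2.
Proof.
elim: k s w => [|k IHk] s w /=; first by rewrite inE => /eqP->.
rewrite inE => /predU1P[->|] //.
case/flatten_mapP => y _; rewrite mem_cat => /orP[] /mapP[v /IHk sv ->] /=; lia.
Qed.

(** The sizes satisfy [a(k+1) = 1 + 2(k+1)a(k)]; the strict inequality absorbs the 1, which counts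
    the empty word. *)
Lemma size_run_words k s : size s = k -> size (run_words k s) < 2 ^ k.+1 * k`!.
Proof.
elim: k s => [|k IHk] s ss //=; rewrite size_flatten /shape -map_comp.
have : {in s, forall y, 2 * size (run_words k (rem y s)) <= 2 * (2 ^ k.+1 * k`!).-1}.
  move=> y ys; have /IHk : size (rem y s) = k by rewrite size_rem ?ss.
  lia.
move=> /sumn_map_leq; rewrite ss (eq_map (f := _ \o _)
  (g := fun y => 2 * size (run_words k (rem y s)))); last first.
  by move=> y /=; rewrite size_cat !size_map mul2n addnn.
rewrite factS [2 ^ k.+2]expnS.
have: 0 < 2 ^ k.+1 * k`! by rewrite muln_gt0 expn_gt0 fact_gt0.
move: (2 ^ k.+1) (k`!) (sumn _) => p f S; nia.
Qed.

(** The middle of Z_2 needs a nonempty image, so the empty [v] is replaced by [[:: x]], giving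
    [xxx]. *)
Definition min_zimin2 s : seq (seq T) :=
  flatten [seq [seq x :: rcons (if v is [::] then [:: x] else v) x
               | v <- run_words (size s).-1 (rem x s)] | x <- s].

Lemma size_min_zimin2 s : 0 < size s ->
  size (min_zimin2 s) < 2 ^ size s * (size s)`!.
Proof.
move=> s_gt0; rewrite size_flatten /shape -map_comp.
set k := (size s).-1; have sE : size s = k.+1 by rewrite /k prednK.
have : {in s, forall x, size (run_words k (rem x s)) <= (2 ^ k.+1 * k`!).-1}.
  move=> x xs; have /size_run_words : size (rem x s) = k by rewrite size_rem.
  lia.
move=> /sumn_map_leq; rewrite (eq_map (f := _ \o _)
  (g := fun x => size (run_words k (rem x s)))); last first.
  by move=> x /=; rewrite size_map.
rewrite sE factS; have: 0 < 2 ^ k.+1 * k`! by rewrite muln_gt0 expn_gt0 fact_gt0.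
move: (2 ^ k.+1) (k`!) (sumn _) => p f S; nia.
Qed.

Lemma contains_min_zimin2 s u : u \in min_zimin2 s -> contains u (zimin 2).
Proof.
case/flatten_mapP => x _ /mapP[v _ ->].
set c := (if v is [::] then _ else _).
exists (fun i => if i == 2 then c else [:: x]); split=> [i _|].
  by case: (i == 2) => //; rewrite /c; case: (v).
by rewrite -cats1; exact: infix_refl.
Qed.

(** Suppose [x] is put before a [short_runs] word that contains it, and cut that word at its first
    [x]. If a nonempty [v1] comes before the cut, [x v1 x] is in the family; otherwise [x] lengthens
    the leading run, to exponent 2 or to [xxx]. *)
Lemma short_runs_or_min_zimin2 s w : {subset w <= s} ->
  short_runs w \/ (exists2 u, u \in min_zimin2 s & infix u w).
Proof.
elim: w => [|x w IHw] ws; first by left.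
have xs : x \in s by apply: ws; rewrite mem_head.
have {}ws : {subset w <= s} by move=> z zw; apply: ws; rewrite inE zw orbT.
have [rw|[u uF uw]] := IHw ws; last first.
  by right; exists u => //; apply: infix_trans uw (infix_cons _ _).
have [xw|xw] := boolP (x \in w); last by left; rewrite /= xw rw.
have minP v : x \notin v -> {subset v <= s} -> short_runs v ->
    x :: rcons (if v is [::] then [:: x] else v) x \in min_zimin2 s.
  move=> xv vs rv; apply/flatten_mapP; exists x => //; apply/mapP; exists v => //.
  by apply: mem_run_words rv; [rewrite size_rem | apply: subset_rem].
have [v1 [v2 [wE xv1]]] : exists v1 v2, w = v1 ++ x :: v2 /\ x \notin v1.
  exists (take (index x w) w), (drop (index x w).+1 w).
  rewrite -[w in w = _](cat_take_drop (index x w)) (drop_nth x) ?index_mem //.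
  by rewrite nth_index // in_take // ltnn.
case: v1 => [|y v1] in wE xv1.
  move: rw; rewrite wE /= => /orP[/andP[xv2 rv2]|].
    by left; rewrite xv2 rv2 eqxx /= orbT.
  case: v2 => [|y v2] // in wE * => /and3P[/eqP <- _ _].
  right; exists [:: x; x; x]; first exact: (minP [::]).
  by rewrite /= !eqxx prefix0s.
right; exists (x :: rcons (y :: v1) x).
  apply: (minP (y :: v1)) => // [z zv|].
    by apply: ws; rewrite wE mem_cat zv.
  by move: rw; rewrite wE => /short_runs_catl.
by rewrite wE -cat_rcons; exact: (prefix_infix (x :: rcons (y :: v1) x) v2).
Qed.

End MinimalZimin2.

Lemma forces_zimin3 q :
  forces_zimin 3 q ((size (min_zimin2 (enum 'I_q))).+1 * (q.*2.+2)).
Proof.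
apply: forces_ziminS => [|w sw]; first exact: contains_min_zimin2.
have ws : {subset w <= enum 'I_q} by move=> x; rewrite mem_enum.
have [rw|//] := short_runs_or_min_zimin2 ws.
have /size_mem_run_words : w \in run_words q (enum 'I_q).
  by apply: mem_run_words rw; rewrite ?size_enum_ord.
by rewrite sw ltnn.
Qed.

Lemma leq_succ_exp n : 4 < n -> 2 * n.+2 * n ^ n <= n.+1 ^ n.+1.
Proof.
case: n => // n n5.
(* The first three binomial terms. For [k = n] and [N = n.+1] they sum to [N^N (5N + 3)/2], which is
   at least [2(N + 2) N^N] exactly when [N >= 5]. *)
have H k : n.+1 ^ k.+2 + k.+2 * n.+1 ^ k.+1 + 'C(k.+2, 2) * n.+1 ^ k <= n.+2 ^ k.+2.
  elim: k => [|k IHk]; first by rewrite binn !expnS !expn0; nia.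
  have: n.+2 * (n.+1 ^ k.+2 + k.+2 * n.+1 ^ k.+1 + 'C(k.+2, 2) * n.+1 ^ k)
    <= n.+2 ^ k.+3 by rewrite [n.+2 ^ k.+3]expnS leq_mul2l.
  apply: leq_trans; rewrite (binS k.+2) bin1 !expnS.
  move: (n.+1 ^ k) ('C(_, _)) => a b; nia.
apply: leq_trans (H n).
have := bin_ffact n.+2 2; rewrite !ffactnS ffactn0 !factS fact0 /= !muln1.
rewrite !expnS; move: ('C(_, _)) (n.+1 ^ n) => a b; nia.
Qed.

(** The left side equals [2 (2^q q!) (2q + 2)]. Raising [q] by one multiplies it by [2(q + 2)], and
    the right side by at least as much. *)
Lemma fact_leq_exp q : 35 <= q -> 2 ^ q.+2 * q.+1`! <= q ^ q.
Proof.
elim: q => // q IHq; rewrite leq_eqVlt => /predU1P[<-|q35].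
  rewrite !factS fact0; lia.
have H : 2 * q.+2 * (2 ^ q.+2 * q.+1`!) <= q.+1 ^ q.+1.
  apply: leq_trans (leq_succ_exp _); last by lia.
  by rewrite leq_mul2l IHq ?orbT.
apply: leq_trans H; rewrite factS (expnS 2 q.+2).
by move: (2 ^ q.+2) (q.+1`!) => a b; nia.
Qed.

(** The next length [(q^m + 1)(m + 1)] exceeds [q^m], so an invariant [m <= T] would not propagate;
    the factor 2 leaves room up to [q^(2m)]. *)
Lemma forces_zimin_tw n q : 35 <= q ->
  exists2 m, forces_zimin n.+3 q m & 0 < m /\ 2 * m <= tw q n.+2 q.
Proof.
move=> q35; elim: n => [|n [m Hm [m_gt0 mT]]].
  eexists; first exact: forces_zimin3.
  split=> //; apply: leq_trans (fact_leq_exp q35).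
  have := @size_min_zimin2 _ (enum 'I_q); rewrite size_enum_ord.
  rewrite factS !expnS; move: (size _) (2 ^ q) (q`!) => a b c; nia.
exists ((q ^ m).+1 * m.+1); first exact: forces_zimin_exp.
split=> //.
have {mT} : q ^ (2 * m) <= tw q n.+3 q by rewrite leq_exp2l //; lia.
apply: leq_trans.
(* As [q^m + 1 <= 2 q^m] and [m + 1 <= 2m], twice the next length is at most [8m q^m]. *)
have : 8 * m <= q ^ m.
  elim: m m_gt0 {Hm} => // -[_ _|m IHm _]; first by rewrite expn1; lia.
  rewrite expnS; move: (IHm isT); move: (q ^ _) => a; nia.
rewrite [2 * m]mul2n -addnn expnD; move: (q ^ m) => a am.
have : a * (8 * m) <= a * a by rewrite leq_mul2l am orbT.
by case: m m_gt0 am {Hm} => // m _; nia.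
Qed.

Theorem theorem2p3 (n q : nat) (hn : 3 <= n) (hq : 35 <= q) :
  zimin_length n q <= tw q (n - 1) q.
Proof.
case: n hn => [|[|[|n]]] // _; rewrite subn1 /=.
have [m Hm [_ mT]] := forces_zimin_tw n hq.
apply: leq_trans (leq_trans (leq_pmull m _) mT) => //.
by have [_] := zimin_lengthP n.+3 q; apply.
Qed.
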